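(* Let $F,G\colon\mathbb A\to\mathbb B$ be pseudo double functors between strict double categories, and suppose that there is a connection on the 1v-components of strong vertical transformations. Then there is a bijection between strong vertical transformations $\alpha_0\colon F\Rightarrow G$ and those strong horizontal transformations $\alpha_1\colon F\Rightarrow G$ whose 1h-cell components are 1h-companions of some 1v-cells.
   Context: Conventions. In a strict double category, $a\colon(f;u,v;g)$ denotes a square with top 1h-cell $f$, left 1v-cell $u$, right 1v-cell $v$, bottom 1h-cell $g$. $[a|b]$ is the horizontal composite ($a$ on the left), $a/b/c$ the vertical composite (first listed on top). $gf$ means first $f$, then $g$. $1_A,1^A$ are horizontal and vertical identities; $\mathrm{Id}_f\colon(f;1^A,1^B;f)$, $\mathrm{Id}^u\colon(1_A;u,u;1_{A'})$. Vertically globular: identity left and right sides; horizontally globular: identity top and bottom. In the data below $f\colon A\to B$, $g\colon B\to C$ are 1h-cells and $u\colon A\to A'$, $v\colon A'\to A''$ are 1v-cells; in axioms about a square $a\colon(f;u,v;g)$ one has $g\colon A'\to B'$, $v\colon B\to B'$. A pseudo double functor $F$ preserves 1v-cells, their composition and identities and vertical composition of squares and the squares $\mathrm{Id}_f$ strictly, and horizontal composition up to coherent, natural, vertically globular, vertically invertible squares $F_{gf}$ (top $F(gf)$, bottom $F(g)F(f)$) and $F_A$ (top $F(1_A)$, bottom $1_{F(A)}$). A strong vertical transformation $\alpha_0\colon F\Rightarrow G$ consists of 1v-cells $\alpha_0(A)\colon F(A)\to G(A)$, squares $(\alpha_0)_f\colon(F(f);\alpha_0(A),\alpha_0(B);G(f))$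 and horizontally globular squares $\delta_{\alpha_0,u}$ (left $\alpha_0(A')F(u)$, right $G(u)\alpha_0(A)$) with: $[F(a)/(\alpha_0)_g\,|\,\delta_{\alpha_0,v}]=[\delta_{\alpha_0,u}\,|\,(\alpha_0)_f/G(a)]$ for squares $a\colon(f;u,v;g)$; $F_{gf}/[(\alpha_0)_f|(\alpha_0)_g]=(\alpha_0)_{gf}/G_{gf}$; $F_A/\mathrm{Id}^{\alpha_0(A)}=(\alpha_0)_{1_A}/G_A$; $\delta_{\alpha_0,vu}=[\mathrm{Id}^{F(u)}/\delta_{\alpha_0,v}\,|\,\delta_{\alpha_0,u}/\mathrm{Id}^{G(v)}]$; $\delta_{\alpha_0,1^A}=\mathrm{Id}^{\alpha_0(A)}$. A strong horizontal transformation $\alpha_1\colon F\Rightarrow G$ consists of 1h-cells $\alpha_1(A)\colon F(A)\to G(A)$, squares $(\alpha_1)_u\colon(\alpha_1(A);F(u),G(u);\alpha_1(A'))$ and vertically globular squares $\delta_{\alpha_1,f}$ (top $\alpha_1(B)F(f)$, bottom $G(f)\alpha_1(A)$) with: $[F(a)|(\alpha_1)_v]/\delta_{\alpha_1,g}=\delta_{\alpha_1,f}/[(\alpha_1)_u|G(a)]$ for squares $a\colon(f;u,v;g)$; $(\alpha_1)_{vu}=(\alpha_1)_u/(\alpha_1)_v$; $(\alpha_1)_{1^A}=\mathrm{Id}_{\alpha_1(A)}$; $\delta_{\alpha_1,gf}=[F_{gf}|\mathrm{Id}_{\alpha_1(C)}]/[\mathrm{Id}_{F(f)}|\delta_{\alpha_1,g}]/[\delta_{\alpha_1,f}|\mathrm{Id}_{G(g)}]/[\mathrm{Id}_{\alpha_1(A)}|G_{gf}^{-1}]$;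 $[F_A^{-1}|\mathrm{Id}_{\alpha_1(A)}]/\delta_{\alpha_1,1_A}/[\mathrm{Id}_{\alpha_1(A)}|G_A]=\mathrm{Id}_{\alpha_1(A)}$. A 1h-companion of a 1v-cell $u\colon A\to A'$ is a 1h-cell $u_*\colon A\to A'$ with squares $\varepsilon_u\colon(u_*;u,1^{A'};1_{A'})$ and $\eta_u\colon(1_A;1^A,u;u_* )$ such that $[\eta_u|\varepsilon_u]=\mathrm{Id}_{u_*}$ and $\eta_u/\varepsilon_u=\mathrm{Id}^u$. A connection on a class of 1v-cells is a functorial choice of a 1h-companion $(u_*,\varepsilon_u,\eta_u)$ for each 1v-cell $u$ in the class; here the class is that of 1v-components $\alpha_0(A)$ of strong vertical transformations. In the statement, 1h-companions are those chosen by the connection, and a strong horizontal transformation whose components are 1h-companions of 1v-cells is taken together with a fixed choice of 1v-cells $\alpha_0(A)$ of which the $\alpha_1(A)$ are the (chosen) 1h-companions. *)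

(* Defs.v *)
From mathcomp Require Import ssreflect ssrfun ssrbool.

Set Implicit Arguments.
Unset Strict Implicit.
Unset Printing Implicit Defensive.

(** In a strict double category the composition laws of 1-cells are
    propositional equalities, so the two sides of an equation between squares
    usually have boundaries that are equal but not convertible.  [a === b] says
    that the boundaries agree and that the squares agree along that
    identification, i.e. that the dependent tuples [(f, u, v, g, a)] and
    [(f', u', v', g', b)] are equal. *)
Inductive sqeq (H V V' H' : Type) (S : H -> V -> V' -> H' -> Type)
    (f : H) (u : V) (v : V') (g : H') (a : S f u v g) :
    forall (f' : H) (u' : V) (v' : V') (g' : H'), S f' u' v' g' -> Prop :=
  sqeq_refl : @sqeq H V V' H' S f u v g a f u v g a.

Notation "a === b" := (sqeq a b) (at level 70, no associativity).

(** Cells are composed in diagrammatic order: the 1h-cell written [gf] in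
    classical order is [f >h> g], and similarly [u >v> v] for 1v-cells.  A
    square [a : sq f u v g] has top [f], left [u], right [v], bottom [g]. *)
Record dblData : Type := DblData {
  ob :> Type;
  hor : ob -> ob -> Type;
  ver : ob -> ob -> Type;
  sq : forall A B A' B' : ob,
    hor A B -> ver A A' -> ver B B' -> hor A' B' -> Type;
  h1 : forall A : ob, hor A A;
  hcomp : forall A B C : ob, hor A B -> hor B C -> hor A C;
  v1 : forall A : ob, ver A A;
  vcomp : forall A A' A'' : ob, ver A A' -> ver A' A'' -> ver A A'';
  Idh : forall (A B : ob) (f : hor A B), sq f (v1 A) (v1 B) f;
  Idv : forall (A A' : ob) (u : ver A A'), sq (h1 A) u u (h1 A');
  hpaste : forall (A B C A' B' C' : ob)
    (f : hor A B) (f' : hor B C) (g : hor A' B') (g' : hor B' C')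
    (u : ver A A') (v : ver B B') (w : ver C C'),
    sq f u v g -> sq f' v w g' -> sq (hcomp f f') u w (hcomp g g');
  vpaste : forall (A B A' B' A'' B'' : ob)
    (f : hor A B) (g : hor A' B') (h : hor A'' B'')
    (u : ver A A') (v : ver B B') (u' : ver A' A'') (v' : ver B' B''),
    sq f u v g -> sq g u' v' h -> sq f (vcomp u u') (vcomp v v') h
}.

Arguments h1 {d} A.
Arguments v1 {d} A.

Notation "f >h> g" := (hcomp f g) (at level 40, left associativity).
Notation "u >v> v" := (vcomp u v) (at level 40, left associativity).
Notation "a <|> b" := (hpaste a b) (at level 45, left associativity).
Notation "a </> b" := (vpaste a b) (at level 45, left associativity).

Record dblCat : Type := DblCat {
  dbl_data :> dblData;
  hcompA : forall (A B C D : dbl_data)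
    (f : hor A B) (g : hor B C) (h : hor C D),
    f >h> (g >h> h) = f >h> g >h> h;
  hcomp1f : forall (A B : dbl_data) (f : hor A B), h1 A >h> f = f;
  hcompf1 : forall (A B : dbl_data) (f : hor A B), f >h> h1 B = f;
  vcompA : forall (A A' A'' A''' : dbl_data)
    (u : ver A A') (v : ver A' A'') (w : ver A'' A'''),
    u >v> (v >v> w) = u >v> v >v> w;
  vcomp1u : forall (A A' : dbl_data) (u : ver A A'), v1 A >v> u = u;
  vcompu1 : forall (A A' : dbl_data) (u : ver A A'), u >v> v1 A' = u;
  hpasteA : forall (A B C D A' B' C' D' : dbl_data)
    (f : hor A B) (g : hor B C) (h : hor C D)
    (f' : hor A' B') (g' : hor B' C') (h' : hor C' D')
    (u : ver A A') (v : ver B B') (w : ver C C') (z : ver D D')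
    (a : sq f u v f') (b : sq g v w g') (c : sq h w z h'),
    a <|> (b <|> c) === a <|> b <|> c;
  hpaste1a : forall (A B A' B' : dbl_data) (f : hor A B) (g : hor A' B')
    (u : ver A A') (v : ver B B') (a : sq f u v g), Idv u <|> a === a;
  hpastea1 : forall (A B A' B' : dbl_data) (f : hor A B) (g : hor A' B')
    (u : ver A A') (v : ver B B') (a : sq f u v g), a <|> Idv v === a;
  vpasteA : forall (A A' A'' A''' B B' B'' B''' : dbl_data)
    (u : ver A A') (u' : ver A' A'') (u'' : ver A'' A''')
    (v : ver B B') (v' : ver B' B'') (v'' : ver B'' B''')
    (f : hor A B) (g : hor A' B') (h : hor A'' B'') (k : hor A''' B''')
    (a : sq f u v g) (b : sq g u' v' h) (c : sq h u'' v'' k),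
    a </> (b </> c) === a </> b </> c;
  vpaste1a : forall (A B A' B' : dbl_data) (f : hor A B) (g : hor A' B')
    (u : ver A A') (v : ver B B') (a : sq f u v g), Idh f </> a === a;
  vpastea1 : forall (A B A' B' : dbl_data) (f : hor A B) (g : hor A' B')
    (u : ver A A') (v : ver B B') (a : sq f u v g), a </> Idh g === a;
  interchange : forall (A B C A' B' C' A'' B'' C'' : dbl_data)
    (f : hor A B) (f' : hor B C) (g : hor A' B') (g' : hor B' C')
    (h : hor A'' B'') (h' : hor B'' C'')
    (u : ver A A') (v : ver B B') (w : ver C C')
    (u' : ver A' A'') (v' : ver B' B'') (w' : ver C' C'')
    (a : sq f u v g) (b : sq f' v w g')
    (c : sq g u' v' h) (d : sq g' v' w' h'),
    (a <|> b) </> (c <|> d) = (a </> c) <|> (b </> d);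
  Idh_comp : forall (A B C : dbl_data) (f : hor A B) (g : hor B C),
    Idh (f >h> g) = Idh f <|> Idh g;
  Idv_comp : forall (A A' A'' : dbl_data) (u : ver A A') (v : ver A' A''),
    Idv (u >v> v) = Idv u </> Idv v;
  Idh_h1 : forall A : dbl_data, Idh (h1 A) = Idv (v1 A)
}.

(** Pasting of squares whose common side agrees only propositionally. *)
Definition hpaste_along (D : dblData) (A B C A' B' C' : D)
    (f : hor A B) (f' : hor B C) (g : hor A' B') (g' : hor B' C')
    (u : ver A A') (v v' : ver B B') (w : ver C C') (e : v = v')
    (a : sq f u v g) :
    sq f' v' w g' -> sq (f >h> f') u w (g >h> g') :=
  match e in _ = x return sq f' x w g' -> _ with erefl => fun b => a <|> b end.

Definition vpaste_along (D : dblData) (A B A' B' A'' B'' : D)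
    (f : hor A B) (g g' : hor A' B') (h : hor A'' B'')
    (u : ver A A') (v : ver B B') (u' : ver A' A'') (v' : ver B' B'')
    (e : g = g') (a : sq f u v g) :
    sq g' u' v' h -> sq f (u >v> u') (v >v> v') h :=
  match e in _ = x return sq x u' v' h -> _ with erefl => fun b => a </> b end.

Notation "a <|> b 'along' e" := (hpaste_along e a b)
  (at level 45, b at next level, left associativity).
Notation "a </> b 'along' e" := (vpaste_along e a b)
  (at level 45, b at next level, left associativity).

Record psFunctor (D E : dblCat) : Type := PsFunctor {
  fob :> D -> E;
  fh : forall A B : D, hor A B -> hor (fob A) (fob B);
  fv : forall A A' : D, ver A A' -> ver (fob A) (fob A');
  fs : forall (A B A' B' : D) (f : hor A B) (u : ver A A') (v : ver B B')
    (g : hor A' B'), sq f u v g -> sq (fh f) (fv u) (fv v) (fh g);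
  (* the comparison squares [F_{gf}] and [F_A], and their vertical inverses *)
  fcomp : forall (A B C : D) (f : hor A B) (g : hor B C),
    sq (fh (f >h> g)) (v1 (fob A)) (v1 (fob C)) (fh f >h> fh g);
  fcompV : forall (A B C : D) (f : hor A B) (g : hor B C),
    sq (fh f >h> fh g) (v1 (fob A)) (v1 (fob C)) (fh (f >h> g));
  funit : forall A : D,
    sq (fh (h1 A)) (v1 (fob A)) (v1 (fob A)) (h1 (fob A));
  funitV : forall A : D,
    sq (h1 (fob A)) (v1 (fob A)) (v1 (fob A)) (fh (h1 A));
  fv_comp : forall (A A' A'' : D) (u : ver A A') (v : ver A' A''),
    fv (u >v> v) = fv u >v> fv v;
  fv_1 : forall A : D, fv (v1 A) = v1 (fob A);
  fs_vpaste : forall (A B A' B' A'' B'' : D)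
    (f : hor A B) (g : hor A' B') (h : hor A'' B'')
    (u : ver A A') (v : ver B B') (u' : ver A' A'') (v' : ver B' B'')
    (a : sq f u v g) (b : sq g u' v' h),
    fs (a </> b) === fs a </> fs b;
  fs_Idh : forall (A B : D) (f : hor A B), fs (Idh f) === Idh (fh f);
  fcompK : forall (A B C : D) (f : hor A B) (g : hor B C),
    fcomp f g </> fcompV f g === Idh (fh (f >h> g));
  fcompVK : forall (A B C : D) (f : hor A B) (g : hor B C),
    fcompV f g </> fcomp f g === Idh (fh f >h> fh g);
  funitK : forall A : D, funit A </> funitV A === Idh (fh (h1 A));
  funitVK : forall A : D, funitV A </> funit A === Idh (h1 (fob A));
  fcomp_nat : forall (A B C A' B' C' : D)
    (f : hor A B) (f' : hor B C) (g : hor A' B') (g' : hor B' C')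
    (u : ver A A') (v : ver B B') (w : ver C C')
    (a : sq f u v g) (b : sq f' v w g'),
    fs (a <|> b) </> fcomp g g' === fcomp f f' </> (fs a <|> fs b);
  funit_nat : forall (A A' : D) (u : ver A A'),
    fs (Idv u) </> funit A' === funit A </> Idv (fv u);
  fcomp_assoc : forall (A B C E : D)
    (f : hor A B) (g : hor B C) (h : hor C E),
    fcomp (f >h> g) h </> (fcomp f g <|> Idh (fh h))
    === fcomp f (g >h> h) </> (Idh (fh f) <|> fcomp g h);
  fcomp_1f : forall (A B : D) (f : hor A B),
    fcomp (h1 A) f </> (funit A <|> Idh (fh f)) === Idh (fh f);
  fcomp_f1 : forall (A B : D) (f : hor A B),
    fcomp f (h1 B) </> (Idh (fh f) <|> funit B) === Idh (fh f)
}.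

Arguments funit {D E} p A.
Arguments funitV {D E} p A.

Record verTrans (D E : dblCat) (F G : psFunctor D E) : Type := VerTrans {
  vt :> forall A : D, ver (F A) (G A);
  vt_sq : forall (A B : D) (f : hor A B), sq (fh F f) (vt A) (vt B) (fh G f);
  vt_delta : forall (A A' : D) (u : ver A A'),
    sq (h1 (F A)) (fv F u >v> vt A') (vt A >v> fv G u) (h1 (G A'));
  vt_nat : forall (A B A' B' : D) (f : hor A B) (u : ver A A')
    (v : ver B B') (g : hor A' B') (a : sq f u v g),
    (fs F a </> vt_sq g) <|> vt_delta v === vt_delta u <|> (vt_sq f </> fs G a);
  vt_sq_comp : forall (A B C : D) (f : hor A B) (g : hor B C),
    fcomp F f g </> (vt_sq f <|> vt_sq g) === vt_sq (f >h> g) </> fcomp G f g;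
  vt_sq_1 : forall A : D,
    funit F A </> Idv (vt A) === vt_sq (h1 A) </> funit G A;
  vt_delta_comp : forall (A A' A'' : D) (u : ver A A') (v : ver A' A''),
    vt_delta (u >v> v)
    === (Idv (fv F u) </> vt_delta v) <|> (vt_delta u </> Idv (fv G v))
          along vcompA (fv F u) (vt A') (fv G v);
  vt_delta_1 : forall A : D, vt_delta (v1 A) === Idv (vt A)
}.

Record horTrans (D E : dblCat) (F G : psFunctor D E) : Type := HorTrans {
  ht :> forall A : D, hor (F A) (G A);
  ht_sq : forall (A A' : D) (u : ver A A'),
    sq (ht A) (fv F u) (fv G u) (ht A');
  ht_delta : forall (A B : D) (f : hor A B),
    sq (fh F f >h> ht B) (v1 (F A)) (v1 (G B)) (ht A >h> fh G f);
  ht_nat : forall (A B A' B' : D) (f : hor A B) (u : ver A A')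
    (v : ver B B') (g : hor A' B') (a : sq f u v g),
    (fs F a <|> ht_sq v) </> ht_delta g === ht_delta f </> (ht_sq u <|> fs G a);
  ht_sq_comp : forall (A A' A'' : D) (u : ver A A') (v : ver A' A''),
    ht_sq (u >v> v) === ht_sq u </> ht_sq v;
  ht_sq_1 : forall A : D, ht_sq (v1 A) === Idh (ht A);
  ht_delta_comp : forall (A B C : D) (f : hor A B) (g : hor B C),
    ht_delta (f >h> g)
    === (fcomp F f g <|> Idh (ht C))
        </> (Idh (fh F f) <|> ht_delta g)
              along esym (hcompA (fh F f) (fh F g) (ht C))
        </> (ht_delta f <|> Idh (fh G g))
              along hcompA (fh F f) (ht B) (fh G g)
        </> (Idh (ht A) <|> fcompV G f g)
              along esym (hcompA (ht A) (fh G f) (fh G g));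
  ht_delta_1 : forall A : D,
    (funitV F A <|> Idh (ht A)) </> ht_delta (h1 A) </> (Idh (ht A) <|> funit G A)
    === Idh (ht A)
}.

Record companion (D : dblCat) (A A' : D) (u : ver A A') : Type := Companion {
  comp_h : hor A A';
  comp_eps : sq comp_h u (v1 A') (h1 A');
  comp_eta : sq (h1 A) (v1 A) u comp_h;
  comp_eta_eps_h : comp_eta <|> comp_eps === Idh comp_h;
  comp_eta_eps_v : comp_eta </> comp_eps === Idv u
}.

Definition verClass (D : dblCat) : Type := forall A A' : D, ver A A' -> Prop.

(** A choice of companions on a class of 1v-cells that is functorial in the
    triples [(comp_h, comp_eps, comp_eta)].  The class need not be closed under
    composition or contain identities, so functoriality is required whenever
    the identity (resp. both factors and their composite) belong to it. *)
Record connection (D : dblCat) (P : verClass D) : Type := Connection {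
  conn :> forall (A A' : D) (u : ver A A'), P A A' u -> companion u;
  conn_1 : forall (A : D) (p : P A A (v1 A)), comp_h (conn p) = h1 A;
  conn_eps_1 : forall (A : D) (p : P A A (v1 A)),
    comp_eps (conn p) === Idh (h1 A);
  conn_eta_1 : forall (A : D) (p : P A A (v1 A)),
    comp_eta (conn p) === Idh (h1 A);
  conn_comp : forall (A A' A'' : D) (u : ver A A') (v : ver A' A'')
    (p : P A A' u) (q : P A' A'' v) (r : P A A'' (u >v> v)),
    comp_h (conn r) = comp_h (conn p) >h> comp_h (conn q);
  conn_eps_comp : forall (A A' A'' : D) (u : ver A A') (v : ver A' A'')
    (p : P A A' u) (q : P A' A'' v) (r : P A A'' (u >v> v)),
    comp_eps (conn r)
    === (comp_eps (conn p) <|> Idh (comp_h (conn q)))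
        </> (Idv v <|> comp_eps (conn q));
  conn_eta_comp : forall (A A' A'' : D) (u : ver A A') (v : ver A' A'')
    (p : P A A' u) (q : P A' A'' v) (r : P A A'' (u >v> v)),
    comp_eta (conn r)
    === (comp_eta (conn p) <|> Idv u)
        </> (Idh (comp_h (conn p)) <|> comp_eta (conn q))
}.

(** The 1v-cells of [E] that are components of a strong vertical transformation
    between some pseudo double functors [D -> E]. *)
Inductive verComponent (D E : dblCat) : verClass E :=
  VerComponent (F G : psFunctor D E) (alpha : verTrans F G) (A : D) :
    verComponent D (alpha A).

(** Strong horizontal transformations whose components are companions, chosen
    by the connection [c], of 1v-cells; the 1v-cells are part of the data. *)
Record companionHorTrans (D E : dblCat) (P : verClass E) (c : connection P)
    (F G : psFunctor D E) : Type := CompanionHorTrans {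
  cht :> horTrans F G;
  cht_ver : forall A : D, ver (F A) (G A);
  cht_in : forall A : D, P (F A) (G A) (cht_ver A);
  cht_comp : forall A : D, cht A = comp_h (c (F A) (G A) (cht_ver A) (cht_in A))
}.

(* Main.v *)
Require Import Defs.
From mathcomp Require Import ssreflect ssrfun ssrbool.
From Stdlib Require Import ClassicalEpsilon FunctionalExtensionality.

(** A companion [k] of [s : X' -> X''] and a companion [l] of [t : Y -> Y'] give
    mutually inverse operations between squares [x] with left side [u >v> s] and
    right side [t >v> v] and squares with top [_ >h> comp_h l], left side [u],
    right side [v] and bottom [comp_h k >h> _]: transposition sends [x] to
    [[u / eta k | x | eps l / v]].  It carries the squares [vt_delta u] to the
    squares [ht_sq u], and [vt_sq f] to [ht_delta f].  A single pasting identity,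
      [transpose ([a / x | y / b]) = [a | transpose y] / [transpose x | b]],
    together with [transpose (Idv s) = Idh (comp_h k)], turns both sides of each
    axiom of a strong vertical transformation into the two sides of the
    corresponding axiom of a strong horizontal transformation, and injectivity of
    transposition gives the converse. *)

Set Implicit Arguments.
Unset Strict Implicit.
Unset Printing Implicit Defensive.

(** Makes gluing independent of the proof that two sides match, and reduces equality of
    transformations to equality of their data. *)
Lemma pirr (P : Prop) (p q : P) : p = q.
Proof. exact: Classical_Prop.proof_irrelevance. Qed.

(** * Squares with unconstrained pasting *)

(* Pasting is total: the boundary of a composite is always the formal
   composite of the boundaries, and its content is [None] when the factors do
   not match.  The laws of a double category then become plain equations. *)
Record psq (D : dblCat) (X Y X' Y' : D) : Type := PSq {
  top : hor X Y;
  lft : ver X X';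
  rgt : ver Y Y';
  bot : hor X' Y';
  body : option (sq top lft rgt bot)
}.

Section PartialSquares.
Variable D : dblCat.

Definition inj (X Y X' Y' : D) (f : hor X Y) (u : ver X X') (v : ver Y Y')
    (g : hor X' Y') (a : sq f u v g) : psq X Y X' Y' :=
  PSq (Some a).

(** Equality of 1v-cells need not be decidable, so matching of the shared side is tested
    classically; the proof obtained is the one along which the squares are glued. *)
Definition hp_body (X Y Z X' Y' Z' : D) (x : psq X Y X' Y')
    (y : psq Y Z Y' Z') :
    option (sq (top x >h> top y) (lft x) (rgt y) (bot x >h> bot y)) :=
  match excluded_middle_informative (rgt x = lft y), body x, body y with
  | left e, Some a, Some b => Some (hpaste_along e a b)
  | _, _, _ => None
  end.

Definition vp_body (X Y X' Y' X'' Y'' : D) (x : psq X Y X' Y')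
    (y : psq X' Y' X'' Y'') :
    option (sq (top x) (lft x >v> lft y) (rgt x >v> rgt y) (bot y)) :=
  match excluded_middle_informative (bot x = top y), body x, body y with
  | left e, Some a, Some b => Some (vpaste_along e a b)
  | _, _, _ => None
  end.

Definition hp (X Y Z X' Y' Z' : D) (x : psq X Y X' Y') (y : psq Y Z Y' Z') :
  psq X Z X' Z' := PSq (hp_body x y).

Definition vp (X Y X' Y' X'' Y'' : D) (x : psq X Y X' Y')
  (y : psq X' Y' X'' Y'') : psq X Y X'' Y'' := PSq (vp_body x y).

Definition idh (X Y : D) (f : hor X Y) : psq X Y X Y := inj (Idh f).
Definition idv (X X' : D) (u : ver X X') : psq X X X' X' := inj (Idv u).

End PartialSquares.

Arguments hp_body : simpl never.
Arguments vp_body : simpl never.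

Infix "<||>" := hp (at level 45, left associativity).
Infix "<//>" := vp (at level 45, left associativity).

(** * Double category laws as equations between total squares *)

Section PartialSquareTheory.
Variable D : dblCat.

Lemma inj_eq (X Y X' Y' : D) (f f' : hor X Y) (u u' : ver X X')
    (v v' : ver Y Y') (g g' : hor X' Y') (a : sq f u v g)
    (b : sq f' u' v' g') : inj a = inj b <-> a === b.
Proof.
split=> [e | []//].
(* A predicate on whole squares lets [e] be rewritten without inverting an equality of dependent
   tuples. *)
pose holds (x : psq X Y X' Y') :=
  if body x is Some a then a === b else False.
have: holds (inj b) by [].
by rewrite -e.
Qed.

Lemma inj_inj (X Y X' Y' : D) (f : hor X Y) (u : ver X X') (v : ver Y Y')
    (g : hor X' Y') : injective (@inj D X Y X' Y' f u v g).
Proof.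
move=> a b /inj_eq ab.
(* Generalizing over the boundary allows elimination of [ab]; the transports are then along loops,
   trivial by proof irrelevance. *)
pose cast f' u' v' g' (b' : sq f' u' v' g') := forall (ef : f' = f) (eu : u' = u)
  (ev : v' = v) (eg : g' = g),
  a = ecast z (sq z _ _ _) ef (ecast z (sq _ z _ _) eu
        (ecast z (sq _ _ z _) ev (ecast z (sq _ _ _ z) eg b'))).
have: cast _ _ _ _ b.
  by case: ab => ef eu ev eg; rewrite (pirr ef erefl) (pirr eu erefl)
    (pirr ev erefl) (pirr eg erefl).
exact: (fun h => h erefl erefl erefl erefl).
Qed.

(** The way back to genuine squares: composites are formed as total squares, and only here is their
    boundary adjusted to a prescribed one. *)
Lemma realize (X Y X' Y' : D) (x : psq X Y X' Y') (f : hor X Y) (u : ver X X')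
    (v : ver Y Y') (g : hor X' Y') :
  body x -> top x = f -> lft x = u -> rgt x = v -> bot x = g ->
  {a : sq f u v g | inj a = x}.
Proof.
case: x => f' u' v' g' [a|] //= _ <- <- <- <-.
by exists a.
Qed.

(** Any proof [e] will do, so strict pasting, with [erefl], and pasting along associativity are
    treated alike. *)
Lemma hp_inj (X Y Z X' Y' Z' : D) (f : hor X Y) (f' : hor Y Z)
    (g : hor X' Y') (g' : hor Y' Z') (u : ver X X') (v v' : ver Y Y')
    (w : ver Z Z') (a : sq f u v g) (b : sq f' v' w g') (e : v = v') :
  inj a <||> inj b = inj (hpaste_along e a b).
Proof.
rewrite /hp /hp_body /=; case: excluded_middle_informative => //= e'.
by rewrite (pirr e' e).
Qed.

Lemma vp_inj (X Y X' Y' X'' Y'' : D) (f : hor X Y) (g g' : hor X' Y')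
    (h : hor X'' Y'') (u : ver X X') (v : ver Y Y') (u' : ver X' X'')
    (v' : ver Y' Y'') (a : sq f u v g) (b : sq g' u' v' h) (e : g = g') :
  inj a <//> inj b = inj (vpaste_along e a b).
Proof.
rewrite /vp /vp_body /=; case: excluded_middle_informative => //= e'.
by rewrite (pirr e' e).
Qed.

Lemma inj_hpaste (X Y Z X' Y' Z' : D) (f : hor X Y) (f' : hor Y Z)
    (g : hor X' Y') (g' : hor Y' Z') (u : ver X X') (v : ver Y Y')
    (w : ver Z Z') (a : sq f u v g) (b : sq f' v w g') :
  inj (a <|> b) = inj a <||> inj b.
Proof. by rewrite (hp_inj _ _ erefl). Qed.

Lemma inj_vpaste (X Y X' Y' X'' Y'' : D) (f : hor X Y) (g : hor X' Y')
    (h : hor X'' Y'') (u : ver X X') (v : ver Y Y') (u' : ver X' X'')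
    (v' : ver Y' Y'') (a : sq f u v g) (b : sq g u' v' h) :
  inj (a </> b) = inj a <//> inj b.
Proof. by rewrite (vp_inj _ _ erefl). Qed.

Lemma body_hp (X Y Z X' Y' Z' : D) (x : psq X Y X' Y') (y : psq Y Z Y' Z') :
  body x -> body y -> rgt x = lft y -> body (x <||> y).
Proof.
rewrite /= /hp_body; case: (body x) (body y) => // a [] // b _ _.
by case: excluded_middle_informative.
Qed.

Lemma body_vp (X Y X' Y' X'' Y'' : D) (x : psq X Y X' Y')
    (y : psq X' Y' X'' Y'') :
  body x -> body y -> bot x = top y -> body (x <//> y).
Proof.
rewrite /= /vp_body; case: (body x) (body y) => // a [] // b _ _.
by case: excluded_middle_informative.
Qed.

Lemma body_hpE (X Y Z X' Y' Z' : D) (x : psq X Y X' Y') (y : psq Y Z Y' Z') :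
  body (x <||> y) -> [/\ body x, body y & rgt x = lft y].
Proof.
rewrite /= /hp_body; case: excluded_middle_informative => //= e.
by case: (body x) (body y) => [a|] [b|].
Qed.

Lemma body_vpE (X Y X' Y' X'' Y'' : D) (x : psq X Y X' Y')
    (y : psq X' Y' X'' Y'') :
  body (x <//> y) -> [/\ body x, body y & bot x = top y].
Proof.
rewrite /= /vp_body; case: excluded_middle_informative => //= e.
by case: (body x) (body y) => [a|] [b|].
Qed.

Lemma psq_eq_none (X Y X' Y' : D) (x y : psq X Y X' Y') :
  top x = top y -> lft x = lft y -> rgt x = rgt y -> bot x = bot y ->
  ~ body x -> ~ body y -> x = y.
Proof.
by case: x y => f u v g [a|] [f' u' v' g' [b|]] //= -> -> -> -> ? ?.
Qed.

(** Two empty squares with equal boundaries are equal, so a law needs checking only when one side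
    has content; that content then yields matching conditions. *)
Lemma psqP (X Y X' Y' : D) (x y : psq X Y X' Y') :
  top x = top y -> lft x = lft y -> rgt x = rgt y -> bot x = bot y ->
  (body x -> x = y) -> (body y -> x = y) -> x = y.
Proof.
move=> *; case bx: (isSome (body x)); first by auto.
case b_y: (isSome (body y)); first by auto.
by apply: psq_eq_none; rewrite ?bx ?b_y.
Qed.

(** No matching condition appears: the factors match in one bracketing exactly when they do in the
    other, and otherwise both composites are empty. *)
Lemma hpA (X Y Z T X' Y' Z' T' : D) (x : psq X Y X' Y') (y : psq Y Z Y' Z')
    (z : psq Z T Z' T') : x <||> (y <||> z) = x <||> y <||> z.
Proof.
apply: psqP; rewrite //= ?hcompA //.
- case/body_hpE=> bx /body_hpE[].
  case: x y z bx => f u v g [a|] [f' u' v' g' [a'|]] [f'' u'' v'' g'' [a''|]] //=.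
  move=> _ _ _ e' e; subst u' u''; rewrite -!/(inj _).
  rewrite !(hp_inj _ _ erefl) /=; apply/inj_eq; exact: hpasteA.
- case/body_hpE=> /body_hpE[].
  case: x y z => f u v g [a|] [f' u' v' g' [a'|]] [f'' u'' v'' g'' [a''|]] //=.
  move=> _ _ e _ e'; subst u' u''; rewrite -!/(inj _).
  rewrite !(hp_inj _ _ erefl) /=; apply/inj_eq; exact: hpasteA.
Qed.

Lemma vpA (X Y X' Y' X'' Y'' X3 Y3 : D) (x : psq X Y X' Y')
    (y : psq X' Y' X'' Y'') (z : psq X'' Y'' X3 Y3) :
  x <//> (y <//> z) = x <//> y <//> z.
Proof.
apply: psqP; rewrite //= ?vcompA //.
- case/body_vpE=> bx /body_vpE[].
  case: x y z bx => f u v g [a|] [f' u' v' g' [a'|]] [f'' u'' v'' g'' [a''|]] //=.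
  move=> _ _ _ e' e; subst f' f''; rewrite -!/(inj _).
  rewrite !(vp_inj _ _ erefl) /=; apply/inj_eq; exact: vpasteA.
- case/body_vpE=> /body_vpE[].
  case: x y z => f u v g [a|] [f' u' v' g' [a'|]] [f'' u'' v'' g'' [a''|]] //=.
  move=> _ _ e _ e'; subst f' f''; rewrite -!/(inj _).
  rewrite !(vp_inj _ _ erefl) /=; apply/inj_eq; exact: vpasteA.
Qed.

Lemma idv_hp (X Y X' Y' : D) (u : ver X X') (x : psq X Y X' Y') :
  lft x = u -> idv u <||> x = x.
Proof.
case: x => f u' v g [a|] /= <-; last first.
  by apply: psq_eq_none; rewrite //= ?hcomp1f // => /body_hpE[].
by rewrite (hp_inj _ _ erefl); apply/inj_eq; exact: hpaste1a.
Qed.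

Lemma hp_idv (X Y X' Y' : D) (v : ver Y Y') (x : psq X Y X' Y') :
  rgt x = v -> x <||> idv v = x.
Proof.
case: x => f u v' g [a|] /= <-; last first.
  by apply: psq_eq_none; rewrite //= ?hcompf1 // => /body_hpE[].
by rewrite (hp_inj _ _ erefl); apply/inj_eq; exact: hpastea1.
Qed.

Lemma idh_vp (X Y X' Y' : D) (f : hor X Y) (x : psq X Y X' Y') :
  top x = f -> idh f <//> x = x.
Proof.
case: x => f' u v g [a|] /= <-; last first.
  by apply: psq_eq_none; rewrite //= ?vcomp1u // => /body_vpE[].
by rewrite (vp_inj _ _ erefl); apply/inj_eq; exact: vpaste1a.
Qed.

Lemma vp_idh (X Y X' Y' : D) (g : hor X' Y') (x : psq X Y X' Y') :
  bot x = g -> x <//> idh g = x.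
Proof.
case: x => f u v g' [a|] /= <-; last first.
  by apply: psq_eq_none; rewrite //= ?vcompu1 // => /body_vpE[].
by rewrite (vp_inj _ _ erefl); apply/inj_eq; exact: vpastea1.
Qed.

(** Matching must be assumed here: content of the left side only makes [bot x >h> bot y] equal to
    [top z >h> top t], which does not make the factors equal. *)
Lemma hp_vp (X Y Z X' Y' Z' X'' Y'' Z'' : D) (x : psq X Y X' Y')
    (y : psq Y Z Y' Z') (z : psq X' Y' X'' Y'') (t : psq Y' Z' Y'' Z'') :
  rgt x = lft y -> rgt z = lft t -> bot x = top z -> bot y = top t ->
  (x <||> y) <//> (z <||> t) = (x <//> z) <||> (y <//> t).
Proof.
case: x y z t => f u v g [a|] [f1 u1 v1 g1 [a1|]] [f2 u2 v2 g2 [a2|]]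
  [f3 u3 v3 g3 [a3|]] /= e1 e2 e3 e4; subst; last first.
all: try by (apply: psq_eq_none => //;
  [case/body_vpE=> /body_hpE[? ? ?] /body_hpE[]
  |case/body_hpE=> /body_vpE[? ? ?] /body_vpE[]]).
rewrite -!/(inj _) !(hp_inj _ _ erefl) !(vp_inj _ _ erefl).
by rewrite (hp_inj _ _ erefl) /= Defs.interchange.
Qed.

Lemma idh_hcomp (X Y Z : D) (f : hor X Y) (g : hor Y Z) :
  idh (f >h> g) = idh f <||> idh g.
Proof. by rewrite (hp_inj _ _ erefl) /idh Idh_comp. Qed.

Lemma idv_vcomp (X Y Z : D) (u : ver X Y) (v : ver Y Z) :
  idv (u >v> v) = idv u <//> idv v.
Proof. by rewrite (vp_inj _ _ erefl) /idv Idv_comp. Qed.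

Lemma idv_v1 (X : D) : idv (v1 X) = idh (h1 X).
Proof. by rewrite /idv /idh Idh_h1. Qed.

End PartialSquareTheory.

(** * Transposition along companions *)

Local Ltac boundary := simpl; repeat match goal with
  | H : top ?x = _ |- context [top ?x] => rewrite H
  | H : lft ?x = _ |- context [lft ?x] => rewrite H
  | H : rgt ?x = _ |- context [rgt ?x] => rewrite H
  | H : bot ?x = _ |- context [bot ?x] => rewrite H
  end; by subst; rewrite /= ?fv_comp ?fv_1 ?vcompA ?hcompA ?vcomp1u ?vcompu1
    ?hcomp1f ?hcompf1.

Section Transposition.
Variable D : dblCat.

Definition eta (X X' : D) (u : ver X X') (k : companion u) : psq X X X X' :=
  inj (comp_eta k).
Definition eps (X X' : D) (u : ver X X') (k : companion u) : psq X X' X' X' :=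
  inj (comp_eps k).

Lemma eta_eps_h (X X' : D) (u : ver X X') (k : companion u) :
  eta k <||> eps k = idh (comp_h k).
Proof. rewrite (hp_inj _ _ erefl); apply/inj_eq; exact: comp_eta_eps_h. Qed.

Lemma eta_eps_v (X X' : D) (u : ver X X') (k : companion u) :
  eta k <//> eps k = idv u.
Proof. rewrite (vp_inj _ _ erefl); apply/inj_eq; exact: comp_eta_eps_v. Qed.

Section Transpose.
Variables (X X' X'' Y Y' Y'' : D) (s : ver X' X'') (t : ver Y Y').
Variables (k : companion s) (l : companion t).

(** The factors [u] and [v] are arguments because the sides of [x] do not record how they
    decompose. *)
Definition transpose (u : ver X X') (v : ver Y' Y'') (x : psq X Y X'' Y'') :
    psq X Y' X' Y'' :=
  (idv u <//> eta k) <||> x <||> (eps l <//> idv v).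

(** The companion ending the top becomes the initial factor [t] of the right side, and the one
    starting the bottom becomes the final factor [s] of the left side. *)
Definition untranspose (f : hor X Y) (g : hor X'' Y'') (y : psq X Y' X' Y'') :
    psq X Y X'' Y'' :=
  (idh f <||> eta l) <//> y <//> (eps k <||> idh g).

(** Padding with identities gives a 3 by 3 grid. Read by columns, each [eta] over its [eps]
    collapses to a vertical identity, leaving [x] between identities. *)
Lemma transposeK (f : hor X Y) (u : ver X X') (v : ver Y' Y'')
    (g : hor X'' Y'') (x : psq X Y X'' Y'') :
  top x = f -> lft x = u >v> s -> rgt x = t >v> v -> bot x = g ->
  untranspose f g (transpose u v x) = x.
Proof.
move=> <- xl xr <-; rewrite /untranspose /transpose.
have -> : idh (top x) <||> eta l = idh (h1 X) <||> idh (top x) <||> eta l.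
  by rewrite -idh_hcomp hcomp1f.
have -> : eps k <||> idh (bot x) = eps k <||> idh (bot x) <||> idh (h1 Y'').
  by rewrite -hpA -idh_hcomp hcompf1.
rewrite -!idv_v1 !hp_vp; try boundary.
rewrite !vpA -idv_vcomp vcomp1u -(vpA (idv u)) eta_eps_v -idv_vcomp.
rewrite eta_eps_v -(vpA (idv t)) -idv_vcomp vcompu1 -idv_vcomp.
rewrite idh_vp // vp_idh //.
by rewrite idv_hp // hp_idv.
Qed.

(** The same grid argument by rows, now with the horizontal companion identity in the top and bottom
    rows. *)
Lemma untransposeK (f : hor X Y) (u : ver X X') (v : ver Y' Y'')
    (g : hor X'' Y'') (y : psq X Y' X' Y'') :
  top y = f >h> comp_h l -> lft y = u -> rgt y = v -> bot y = comp_h k >h> g ->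
  transpose u v (untranspose f g y) = y.
Proof.
move=> yt <- <- yb; rewrite /untranspose /transpose.
have -> : idv (lft y) <//> eta k = idv (v1 X) <//> idv (lft y) <//> eta k.
  by rewrite -idv_vcomp vcomp1u.
have -> : eps l <//> idv (rgt y) = eps l <//> idv (rgt y) <//> idv (v1 Y'').
  by rewrite -vpA -idv_vcomp vcompu1.
rewrite !idv_v1 -!hp_vp; try boundary.
rewrite !hpA -idh_hcomp hcomp1f -(hpA (idh f)) eta_eps_h -idh_hcomp.
rewrite eta_eps_h -(hpA (idh (comp_h k))) -idh_hcomp hcompf1 -idh_hcomp.
rewrite idv_hp // hp_idv //.
by rewrite idh_vp // vp_idh.
Qed.

Lemma transpose_eq (u : ver X X') (v : ver Y' Y'') (x y : psq X Y X'' Y'') :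
  lft x = u >v> s -> rgt x = t >v> v -> lft y = u >v> s -> rgt y = t >v> v ->
  top x = top y -> bot x = bot y ->
  x = y <-> transpose u v x = transpose u v y.
Proof.
move=> xl xr yl yr xyt xyb; split=> [-> // | e].
by rewrite -(transposeK xyt xl xr xyb) e transposeK.
Qed.

Lemma body_transpose (u : ver X X') (v : ver Y' Y'') (x : psq X Y X'' Y'') :
  body x -> lft x = u >v> s -> rgt x = t >v> v -> body (transpose u v x).
Proof. by move=> bx xl xr; rewrite !body_hp ?body_vp. Qed.

Lemma body_untranspose (f : hor X Y) (g : hor X'' Y'') (y : psq X Y' X' Y'') :
  body y -> top y = f >h> comp_h l -> bot y = comp_h k >h> g ->
  body (untranspose f g y).
Proof. by move=> bx xl xr; rewrite !body_vp ?body_hp. Qed.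

End Transpose.

Lemma transpose_idv (X X' : D) (s : ver X X') (k : companion s) :
  transpose k k (v1 X) (v1 X') (idv s) = idh (comp_h k).
Proof.
rewrite /transpose !idv_v1 idh_vp // vp_idh // hp_idv //.
exact: eta_eps_h.
Qed.

(* In the composite on the right, [eta k] and [eps k] meet along the companion
   of [s] and cancel to the identity of [s], which is absorbed. *)
Lemma transpose_paste (X Y Z X1 Y1 Z1 X2 Y2 Z2 X3 Y3 Z3 : D)
    (r : ver X2 X3) (s : ver Y1 Y2) (t : ver Z Z1)
    (j : companion r) (k : companion s) (l : companion t)
    (a : psq X Y X1 Y1) (x : psq X1 Y1 X3 Y3)
    (y : psq Y Z Y2 Z2) (b : psq Y2 Z2 Y3 Z3) (u : ver X1 X2) (w : ver Z1 Z2)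
    (p : ver X X2) (q : ver Z1 Z3) (m : ver Y Y1) (n : ver Y2 Y3) :
  p = lft a >v> u -> q = w >v> rgt b -> m = rgt a -> n = lft b ->
  bot a = top x -> bot y = top b ->
  lft x = u >v> r -> rgt x = s >v> n -> lft y = m >v> s -> rgt y = t >v> w ->
  transpose j l p q ((a <//> x) <||> (y <//> b))
  = (a <||> transpose k l m w y) <//> (transpose j k u n x <||> b).
Proof.
(* The first four equations let callers present sides in any provably equal form, such as
   [fv F (u >v> v)] for a composite. *)
move=> -> -> -> -> ax yb xl xr yl yr.
(* An outer identity gives each row five factors, so that interchange applies column by column. *)
have -> : a <||> transpose k l (rgt a) w y = idv (lft a) <||> a
    <||> (idv (rgt a) <//> eta k) <||> y <||> (eps l <//> idv w).
  by rewrite /transpose !hpA idv_hp.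
have -> : transpose j k u (lft b) x <||> b = idv u <//> eta j <||> x
    <||> (eps k <//> idv (lft b)) <||> b <||> idv (rgt b).
  by rewrite /transpose hp_idv.
rewrite !hp_vp; try boundary.
rewrite !vpA -(vpA (idv (rgt a))) eta_eps_v -!idv_vcomp -(vpA (eps l)) -idv_vcomp.
rewrite hp_idv; last by boundary.
by rewrite /transpose !hpA.
Qed.

End Transposition.

(** * Correspondence of the axioms *)

Section Correspondence.
Variables (A B : dblCat) (F G : psFunctor A B).
Variables (al : forall X : A, ver (F X) (G X)) (k : forall X, companion (al X)).
(** [h] is kept apart from [comp_h (k X)] because the components of a given horizontal
    transformation are companions only up to a propositional equality. *)
Variables (h : forall X : A, hor (F X) (G X)) (hE : forall X, h X = comp_h (k X)).
Variables
  (vsq : forall (X Y : A) (f : hor X Y), sq (fh F f) (al X) (al Y) (fh G f))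
  (vdelta : forall (X X' : A) (u : ver X X'),
    sq (h1 (F X)) (fv F u >v> al X') (al X >v> fv G u) (h1 (G X')))
  (hsq : forall (X X' : A) (u : ver X X'), sq (h X) (fv F u) (fv G u) (h X'))
  (hdelta : forall (X Y : A) (f : hor X Y),
    sq (fh F f >h> h Y) (v1 (F X)) (v1 (G Y)) (h X >h> fh G f)).

(** The two families of squares are linked only by transposition, so each equivalence below serves
    both directions of the bijection. *)
Hypothesis hsqE : forall (X X' : A) (u : ver X X'),
  inj (hsq u) = transpose (k X') (k X) (fv F u) (fv G u) (inj (vdelta u)).
Hypothesis hdeltaE : forall (X Y : A) (f : hor X Y),
  inj (hdelta f) = transpose (k X) (k Y) (v1 _) (v1 _) (inj (vsq f)).

(** With an identity placed below [vdelta v] and above [vdelta u], both sides take the form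
    [[a / x | y / b]] and the pasting identity applies. *)
Lemma nat_iff (X Y X' Y' : A) (f : hor X Y) (u : ver X X') (v : ver Y Y')
    (g : hor X' Y') (a : sq f u v g) :
  (fs F a </> vsq g) <|> vdelta v === vdelta u <|> (vsq f </> fs G a)
  <-> (fs F a <|> hsq v) </> hdelta g === hdelta f </> (hsq u <|> fs G a).
Proof.
rewrite -!inj_eq !inj_hpaste !inj_vpaste !inj_hpaste.
rewrite (@transpose_eq _ _ _ _ _ _ _ _ _ (k X') (k Y) (fv F u) (fv G v));
  try boundary.
rewrite -[inj (vdelta v)](vp_idh (g := h1 _)) //.
rewrite -[inj (vdelta u)](idh_vp (f := h1 _)) //.
rewrite (transpose_paste (u := v1 _) (w := fv G v) (m := fv F v) (n := v1 _)
  _ (k Y') _); try boundary.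
rewrite (transpose_paste (u := fv F u) (w := v1 _) (m := v1 _) (n := fv G u)
  _ (k X) _); try boundary.
by rewrite -!hsqE -!hdeltaE -!idv_v1 hp_idv // idv_hp.
Qed.

(** The right side already has the form [[a / x | y / b]], with [a] and [b] vertical identities that
    are absorbed after transposition. *)
Lemma delta_comp_iff (X X' X'' : A) (u : ver X X') (v : ver X' X'') :
  vdelta (u >v> v) === (Idv (fv F u) </> vdelta v) <|> (vdelta u </> Idv (fv G v))
    along vcompA (fv F u) (al X') (fv G v)
  <-> hsq (u >v> v) === hsq u </> hsq v.
Proof.
rewrite -!inj_eq -hp_inj !inj_vpaste hsqE.
rewrite (@transpose_eq _ _ _ _ _ _ _ _ _ (k X'') (k X)
  (fv F (u >v> v)) (fv G (u >v> v))); try boundary.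
rewrite -!/(idv _).
rewrite (transpose_paste (u := fv F v) (w := fv G u) (m := fv F u) (n := fv G v)
  _ (k X') _); try boundary.
by rewrite -!hsqE idv_hp // hp_idv.
Qed.

Lemma delta_1_iff (X : A) :
  vdelta (v1 X) === Idv (al X) <-> hsq (v1 X) === Idh (h X).
Proof.
rewrite -!inj_eq -/(idv _) -/(idh _) hsqE hE -(transpose_idv (k X)).
have -> : transpose (k X) (k X) (v1 _) (v1 _) (idv (al X))
  = transpose (k X) (k X) (fv F (v1 X)) (fv G (v1 X)) (idv (al X)).
  by rewrite !fv_1.
by apply: transpose_eq; boundary.
Qed.

(** Transposing the right side gives [hdelta (f >h> g)] over [fcomp G f g]; this last factor is
    moved across by its vertical inverse. *)
Lemma sq_comp_iff (X Y Z : A) (f : hor X Y) (g : hor Y Z) :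
  fcomp F f g </> (vsq f <|> vsq g) === vsq (f >h> g) </> fcomp G f g
  <-> hdelta (f >h> g)
    === (fcomp F f g <|> Idh (h Z))
        </> (Idh (fh F f) <|> hdelta g)
              along esym (hcompA (fh F f) (fh F g) (h Z))
        </> (hdelta f <|> Idh (fh G g))
              along hcompA (fh F f) (h Y) (fh G g)
        </> (Idh (h X) <|> fcompV G f g)
              along esym (hcompA (h X) (fh G f) (fh G g)).
Proof.
rewrite -!inj_eq -!vp_inj !inj_vpaste !inj_hpaste -!/(idh _).
have GK : inj (fcomp G f g) <//> inj (fcompV G f g) = idh (fh G (f >h> g)).
  by rewrite -inj_vpaste; apply/inj_eq; exact: fcompK.
have GVK : inj (fcompV G f g) <//> inj (fcomp G f g) = idh (fh G f >h> fh G g).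
  by rewrite -inj_vpaste; apply/inj_eq; exact: fcompVK.
rewrite (@transpose_eq _ _ _ _ _ _ _ _ _ (k X) (k Z) (v1 _) (v1 _)); try boundary.
have -> : transpose (k X) (k Z) (v1 _) (v1 _)
    (inj (fcomp F f g) <//> (inj (vsq f) <||> inj (vsq g)))
  = (inj (fcomp F f g) <||> idh (h Z)) <//> (idh (fh F f) <||> inj (hdelta g))
    <//> (inj (hdelta f) <||> idh (fh G g)).
  (* First use of the pasting identity, at [k Z]: the added column [idv (al Z)] transposes to the
     identity of [h Z]. *)
  rewrite -[_ <//> _](hp_idv (v := al Z)); last by boundary.
  rewrite -[idv (al Z)](vp_idh (g := h1 _)) //.
  rewrite (transpose_paste (u := v1 _) (w := v1 _) (m := v1 _) (n := v1 _)
    _ (k Z) _); try boundary.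
  rewrite transpose_idv -hE -idv_v1 hp_idv; last by boundary.
  (* Second use, at [k Y]: identities stagger [vsq f] and [vsq g] into different rows. *)
  rewrite -[inj (vsq f)](idh_vp (f := fh F f)) //.
  rewrite -[inj (vsq g)](vp_idh (g := fh G g)) //.
  rewrite (transpose_paste (u := v1 _) (w := v1 _) (m := v1 _) (n := v1 _)
    _ (k Y) _); try boundary.
  by rewrite -!hdeltaE vpA.
have -> : transpose (k X) (k Z) (v1 _) (v1 _)
    (inj (vsq (f >h> g)) <//> inj (fcomp G f g))
  = inj (hdelta (f >h> g)) <//> (idh (h X) <||> inj (fcomp G f g)).
  rewrite -[_ <//> _](idv_hp (u := al X)); last by boundary.
  rewrite -[idv (al X)](idh_vp (f := h1 _)) //.
  rewrite (transpose_paste (u := v1 _) (w := v1 _) (m := v1 _) (n := v1 _)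
    _ (k X) _); try boundary.
  by rewrite transpose_idv -hE -idv_v1 idv_hp // -hdeltaE.
split=> [-> | ->].
  rewrite -vpA hp_vp // GK idh_vp // -idh_hcomp vp_idh //.
rewrite -(vpA _ (idh (h X) <||> inj (fcompV G f g))) hp_vp // GVK.
rewrite idh_vp // -idh_hcomp vp_idh //; boundary.
Qed.

(** After transposition [funit F X], pasted with the identity of [h X], stands alone on the left and
    is cancelled by its inverse. *)
Lemma sq_1_iff (X : A) :
  funit F X </> Idv (al X) === vsq (h1 X) </> funit G X
  <-> (funitV F X <|> Idh (h X)) </> hdelta (h1 X) </> (Idh (h X) <|> funit G X)
      === Idh (h X).
Proof.
rewrite -!inj_eq !inj_vpaste !inj_hpaste -!/(idh _) -/(idv _).
have FK : inj (funit F X) <//> inj (funitV F X) = idh (fh F (h1 X)).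
  by rewrite -inj_vpaste; apply/inj_eq; exact: funitK.
have FVK : inj (funitV F X) <//> inj (funit F X) = idh (h1 (F X)).
  by rewrite -inj_vpaste; apply/inj_eq; exact: funitVK.
rewrite (@transpose_eq _ _ _ _ _ _ _ _ _ (k X) (k X) (v1 _) (v1 _)); try boundary.
have -> : transpose (k X) (k X) (v1 _) (v1 _) (inj (funit F X) <//> idv (al X))
  = inj (funit F X) <||> idh (h X).
  rewrite -[_ <//> _](hp_idv (v := al X)); last by boundary.
  rewrite -{2}[idv (al X)](vp_idh (g := h1 _)) //.
  rewrite (transpose_paste (u := v1 _) (w := v1 _) (m := v1 _) (n := v1 _)
    _ (k X) _); try boundary.
  rewrite transpose_idv -hE -idv_v1 hp_idv // vp_idh //; boundary.
have -> : transpose (k X) (k X) (v1 _) (v1 _)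
    (inj (vsq (h1 X)) <//> inj (funit G X))
  = inj (hdelta (h1 X)) <//> (idh (h X) <||> inj (funit G X)).
  rewrite -[_ <//> _](idv_hp (u := al X)); last by boundary.
  rewrite -[idv (al X)](idh_vp (f := h1 _)) //.
  rewrite (transpose_paste (u := v1 _) (w := v1 _) (m := v1 _) (n := v1 _)
    _ (k X) _); try boundary.
  by rewrite transpose_idv -hE -idv_v1 idv_hp // -hdeltaE.
split=> [e | e].
  rewrite -vpA -e hp_vp // FVK idh_vp // -idh_hcomp hcomp1f //.
rewrite -[LHS](vp_idh (g := h X)); last by boundary.
(* Only the identity just appended is expanded by [e], bringing [funitV F X] directly below
   [funit F X]. *)
rewrite -{2}e !vpA hp_vp // FK vp_idh // -idh_hcomp idh_vp //.
Qed.

End Correspondence.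

(** * The bijection *)

Section Bijection.
Variables (A B : dblCat) (F G : psFunctor A B).

(** Comparing squares through [inj] makes sense before the components are identified; afterwards
    [inj_inj] gives genuine equality. *)
Lemma verTrans_ext (al be : verTrans F G) :
  (forall X, al X = be X) ->
  (forall (X Y : A) (f : hor X Y), inj (vt_sq al f) = inj (vt_sq be f)) ->
  (forall (X X' : A) (u : ver X X'),
    inj (vt_delta al u) = inj (vt_delta be u)) ->
  al = be.
Proof.
case: al be => [a s d p1 p2 p3 p4 p5] [a' s' d' q1 q2 q3 q4 q5] /= ea es ed.
have ? : a = a' by apply: functional_extensionality_dep.
subst a'.
have ? : s = s'.
  do 3!apply: functional_extensionality_dep => ?; exact/inj_inj/es.
have ? : d = d'.
  do 3!apply: functional_extensionality_dep => ?; exact/inj_inj/ed.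
subst s' d'; congr VerTrans; exact: pirr.
Qed.

Lemma horTrans_ext (al be : horTrans F G) :
  (forall X, al X = be X) ->
  (forall (X X' : A) (u : ver X X'), inj (ht_sq al u) = inj (ht_sq be u)) ->
  (forall (X Y : A) (f : hor X Y), inj (ht_delta al f) = inj (ht_delta be f)) ->
  al = be.
Proof.
case: al be => [a s d p1 p2 p3 p4 p5] [a' s' d' q1 q2 q3 q4 q5] /= ea es ed.
have ? : a = a' by apply: functional_extensionality_dep.
subst a'.
have ? : s = s'.
  do 3!apply: functional_extensionality_dep => ?; exact/inj_inj/es.
have ? : d = d'.
  do 3!apply: functional_extensionality_dep => ?; exact/inj_inj/ed.
subst s' d'; congr HorTrans; exact: pirr.
Qed.

Lemma companionHorTrans_ext (P : verClass B) (c : connection P)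
    (x y : companionHorTrans c F G) :
  cht x = cht y -> (forall X, cht_ver x X = cht_ver y X) -> x = y.
Proof.
case: x y => [t a p e] [t' a' p' e'] /= et ea.
have ? : a = a' by apply: functional_extensionality_dep.
subst t' a'; have ? := pirr p p'; subst p'.
by congr CompanionHorTrans; exact: pirr.
Qed.

(** * From vertical to horizontal transformations *)

Section HorOfVer.
Variables (al : verTrans F G) (k : forall X, companion (al X)).

(** The square is opaque and used only through the accompanying equation. *)
Definition hsq_of_ver (X X' : A) (u : ver X X') :
  {a : sq (comp_h (k X)) (fv F u) (fv G u) (comp_h (k X'))
  | inj a = transpose (k X') (k X) (fv F u) (fv G u) (inj (vt_delta al u))}.
Proof. by apply: realize; [apply: body_transpose | boundary..]. Qed.

Definition hdelta_of_ver (X Y : A) (f : hor X Y) :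
  {a : sq (fh F f >h> comp_h (k Y)) (v1 (F X)) (v1 (G Y))
         (comp_h (k X) >h> fh G f)
  | inj a = transpose (k X) (k Y) (v1 _) (v1 _) (inj (vt_sq al f))}.
Proof. by apply: realize; [apply: body_transpose; boundary | boundary..]. Qed.

Let hsqE X X' (u : ver X X') := svalP (hsq_of_ver u).
Let hdeltaE X Y (f : hor X Y) := svalP (hdelta_of_ver f).
Let refl (X : A) : comp_h (k X) = comp_h (k X) := erefl.

Definition hor_of_ver : horTrans F G := @HorTrans A B F G
  (fun X => comp_h (k X))
  (fun X X' u => sval (hsq_of_ver u))
  (fun X Y f => sval (hdelta_of_ver f))
  (fun X Y X' Y' f u v g a =>
     (nat_iff hsqE hdeltaE a).1 (vt_nat al a))
  (fun X X' X'' u v => (delta_comp_iff hsqE u v).1 (vt_delta_comp al u v))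
  (fun X => (delta_1_iff refl hsqE X).1 (vt_delta_1 al X))
  (fun X Y Z f g => (sq_comp_iff refl hdeltaE f g).1 (vt_sq_comp al f g))
  (fun X => (sq_1_iff refl hdeltaE X).1 (vt_sq_1 al X)).

End HorOfVer.

(** * From horizontal to vertical transformations *)

Section VerOfHor.
Variables (be : horTrans F G) (al : forall X : A, ver (F X) (G X)).
Variables (k : forall X, companion (al X)).
Hypothesis beE : forall X, be X = comp_h (k X).

Definition vsq_of_hor (X Y : A) (f : hor X Y) :
  {a : sq (fh F f) (al X) (al Y) (fh G f)
  | inj a = untranspose (k X) (k Y) (fh F f) (fh G f) (inj (ht_delta be f))}.
Proof.
by apply: realize; [apply: body_untranspose => //=; rewrite beE | boundary..].
Qed.

Definition vdelta_of_hor (X X' : A) (u : ver X X') :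
  {a : sq (h1 (F X)) (fv F u >v> al X') (al X >v> fv G u) (h1 (G X'))
  | inj a = untranspose (k X') (k X) (h1 _) (h1 _) (inj (ht_sq be u))}.
Proof.
apply: realize; [apply: body_untranspose => //=; rewrite beE; boundary
  | boundary..].
Qed.

(** Since transposing undoes untransposing, the constructed data satisfy the link required by the
    correspondence of axioms. *)
Lemma hsqE_of_hor (X X' : A) (u : ver X X') :
  inj (ht_sq be u)
  = transpose (k X') (k X) (fv F u) (fv G u) (inj (sval (vdelta_of_hor u))).
Proof.
rewrite (svalP (vdelta_of_hor u)) untransposeK //= beE; boundary.
Qed.

Lemma hdeltaE_of_hor (X Y : A) (f : hor X Y) :
  inj (ht_delta be f)
  = transpose (k X) (k Y) (v1 _) (v1 _) (inj (sval (vsq_of_hor f))).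
Proof.
by rewrite (svalP (vsq_of_hor f)) untransposeK //= beE.
Qed.

Definition ver_of_hor : verTrans F G := @VerTrans A B F G al
  (fun X Y f => sval (vsq_of_hor f))
  (fun X X' u => sval (vdelta_of_hor u))
  (fun X Y X' Y' f u v g a =>
     (nat_iff hsqE_of_hor hdeltaE_of_hor a).2 (ht_nat be a))
  (fun X Y Z f g => (sq_comp_iff beE hdeltaE_of_hor f g).2 (ht_delta_comp be f g))
  (fun X => (sq_1_iff beE hdeltaE_of_hor X).2 (ht_delta_1 be X))
  (fun X X' X'' u v =>
     (delta_comp_iff hsqE_of_hor u v).2 (ht_sq_comp be u v))
  (fun X => (delta_1_iff beE hsqE_of_hor X).2 (ht_sq_1 be X)).

End VerOfHor.

End Bijection.

Theorem corollary5p3 (A B : dblCat) (F G : psFunctor A B)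
    (c : connection (@verComponent A B)) :
  exists Phi : verTrans F G -> companionHorTrans c F G, bijective Phi.
Proof.
pose k (al : verTrans F G) X := c _ _ (al X) (VerComponent al X).
pose Phi (al : verTrans F G) : companionHorTrans c F G :=
  @CompanionHorTrans _ _ _ c F G (hor_of_ver (k al)) al
    (fun X => VerComponent al X) (fun X => erefl).
pose Psi (x : companionHorTrans c F G) : verTrans F G :=
  ver_of_hor (cht_comp x).
exists Phi, Psi => [al | x].
- apply: verTrans_ext => [X | X Y f | X X' u] //.
    rewrite (svalP (vsq_of_hor _ _)) (svalP (hdelta_of_ver _ _)).
    by rewrite transposeK //; boundary.
  rewrite (svalP (vdelta_of_hor _ _)) (svalP (hsq_of_ver _ _)).
  by rewrite transposeK //; boundary.
(* The same 1v-cell lies in the class by two proofs, one from [Psi x] and one stored in [x]; proof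
   irrelevance makes the chosen companions equal. *)
have kE X : k (Psi x) X = c _ _ (cht_ver x X) (cht_in x X).
  by rewrite /k (pirr (VerComponent (Psi x) X) (cht_in x X)).
apply: companionHorTrans_ext => //; apply: horTrans_ext => [X | X X' u | X Y f].
- by rewrite [RHS]cht_comp -kE.
- by rewrite (svalP (hsq_of_ver _ _)) !kE -hsqE_of_hor.
- by rewrite (svalP (hdelta_of_ver _ _)) !kE -hdeltaE_of_hor.
Qed.
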